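(* Let $G_0 \xleftarrow{\varphi_0} G_1 \xleftarrow{\varphi_1} G_2 \xleftarrow{\varphi_2}\cdots$ be a sequence of covers of graphs with inverse limit $(X,f)$, and let $\mu\in\mathcal{P}_f$. Let $\mathbf{N}\subseteq\mathbb{N}$ be an infinite subset and let $\mathcal{C}=\{\mathcal{C}_n\}_{n\in\mathbf{N}}$ be a system of circuits enumerated by $\mathbf{N}$. Suppose that $\mu$ is expressed by $\mathcal{C}$, and that $\bar\mu=(\mu_0,\mu_1,\dots)$ is written with $\mu_n=\sum_{c\in\mathcal{C}_n}s(c)\tilde{c}$, $s(c)\ge0$ for all $c\in\mathcal{C}_n$, for all $n\in\mathbf{N}$. For $n>m$ and $\epsilon>0$, let $\mathcal{C}(\mu,m,n,\epsilon):=\{c\in\mathcal{C}_n : d(\mu_m,\xi_{n,m}(\tilde{c}))\le\epsilon\}$. Consider the conditions: (1) $\mu$ is ergodic; (2) for all $m\in\mathbf{N}$ and all $\epsilon>0$, $\lim_{n\to\infty}\sum_{c\in\mathcal{C}(\mu,m,n,\epsilon)}s(c)=1$ (limit over $n\in\mathbf{N}$). Then (1) implies (2). Moreover, if for every $n\in\mathbf{N}$ the set $\mathrm{Circ}(G_n)$ of all circuits of $G_n$ (not merely $\mathcal{C}_n$) is linearly independent, then (1) and (2) are equivalent.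
   Context: A graph is a pair $G=(V,E)$ with $V$ a finite set and $E \subseteq V\times V$ such that for each $v\in V$ there are edges $(u_1,v),(v,u_2)\in E$. A graph homomorphism $\varphi:(V_1,E_1)\to(V_2,E_2)$ is a map $\varphi:V_1\to V_2$ with $(\varphi\times\varphi)(E_1)\subseteq E_2$; for $e=(u,v)\in E_1$ write $\varphi(e)=(\varphi(u),\varphi(v))$. It is a cover if $(\varphi\times\varphi)(E_1)=E_2$ and $(u,v),(u,v')\in E_1$ implies $\varphi(v)=\varphi(v')$. In a sequence of covers, write $G_n=(V_n,E_n)$, $n\in\mathbb{N}=\{0,1,2,\dots\}$; each $\varphi_n:G_{n+1}\to G_n$ is a cover and $G_0=(\{0\},\{(0,0)\})$. For $m>n$, $\varphi_{m,n}:=\varphi_n\circ\cdots\circ\varphi_{m-1}$. The inverse limit $(X,f)$ is: $X=\{(x_0,x_1,\dots)\in\prod_i V_i : x_i=\varphi_i(x_{i+1})\ \forall i\}$ with the product topology, and $f:X\to X$ is the continuous surjection whose graph is $\{(x,y): (x_i,y_i)\in E_i\ \forall i\}$. For $v\in V_n$, $U(v)=\{x\in X:x_n=v\}$; for $e=(u,v)\in E_n$, $U(e)=U(u)\cap f^{-1}(U(v))$. $\mathcal{P}_f$ is the set of $f$-invariant Borel probability measures on $X$. For a graph $G=(V,E)$, $\mathcal{P}(G)$ is the set of formal sums $\sum_{e\in E}a(e)e$ (in $\mathbb{R}^E$) with all $a(e)\ge0$, $\sum_e a(e)=1$, and, for every $v\in V$, $\sum_{(u,v)\in E}a((u,v))=\sum_{(v,u)\in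 E}a((v,u))$. Put $\Delta_n=\mathcal{P}(G_n)$; for $m>n$, $\xi_{m,n}:\Delta_m\to\Delta_n$ is $\xi_{m,n}(\sum a(e)e)=\sum a(e)\varphi_{m,n}(e)$. For $\mu\in\mathcal{P}_f$, $\bar\mu=(\mu_0,\mu_1,\dots)$ with $\mu_n=\sum_{e\in E_n}\mu(U(e))e\in\Delta_n$. $d$ denotes the Euclidean distance on $\Delta_m\subset\mathbb{R}^{E_m}$. A circuit of $G$ is a closed walk $(v_0,\dots,v_l)$, $l\ge1$, $(v_i,v_{i+1})\in E$, $v_0=v_l$, with $v_0,\dots,v_{l-1}$ pairwise distinct, regarded as a subgraph $c$ with edge set $E(c)$ and period $\mathrm{Per}(c)=l$; $\mathrm{Circ}(G)$ is the set of all circuits of $G$. A circuit $c$ is identified with $\sum_{e\in E(c)}e\in\mathbb{R}^E$ (linear independence is understood in $\mathbb{R}^E$), and $\tilde{c}=(1/\mathrm{Per}(c))\,c\in\mathcal{P}(G)$. A system of circuits enumerated by $\mathbf{N}$ is a sequence $\{\mathcal{C}_n\}_{n\in\mathbf{N}}$ with $\mathcal{C}_n\subseteq\mathrm{Circ}(G_n)$. It expresses $\mu$ if for all $n\in\mathbf{N}$, $\mu_n=\sum_{c\in\mathcal{C}_n}s(c)\tilde{c}$ for some $s(c)\ge0$ ($c\in\mathcal{C}_n$); the coefficients are chosen separately for each $n$. *)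

(* Defs.v *)
From HB Require Import structures.
From mathcomp Require Import all_boot all_order all_algebra.
From mathcomp Require Import all_classical all_reals all_analysis.

Set Implicit Arguments.
Unset Strict Implicit.
Unset Printing Implicit Defensive.

Import Order.TTheory GRing.Theory Num.Theory.
Import numFieldNormedType.Exports.

Local Open Scope classical_set_scope.
Local Open Scope ring_scope.

Record graph := Graph {
  vertex :> finType;
  edges : {set vertex * vertex};
  edge_in : forall v, exists u, (u, v) \in edges;
  edge_out : forall v, exists u, (v, u) \in edges }.

Definition edge (G : graph) : finType := {e : G * G | e \in edges G}.

Definition source (G : graph) (e : edge G) : G := (sval e).1.
Definition target (G : graph) (e : edge G) : G := (sval e).2.

Definition graph_hom (G H : graph) (phi : G -> H) : Prop :=
  [set (phi e.1, phi e.2) | e in edges G]%SET \subset edges H.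

(* The equality of edge sets subsumes [graph_hom phi]. *)
Definition graph_cover (G H : graph) (phi : G -> H) : Prop :=
  [set (phi e.1, phi e.2) | e in edges G]%SET = edges H /\
  (forall u v v' : G,
     (u, v) \in edges G -> (u, v') \in edges G -> phi v = phi v').

Lemma cover_hom (G H : graph) (phi : G -> H) : graph_cover phi -> graph_hom phi.
Proof. by case=> eqE _; rewrite /graph_hom eqE. Qed.

Lemma cover_edge (G H : graph) (phi : G -> H) (u v : G) : graph_cover phi ->
  (u, v) \in edges G -> (phi u, phi v) \in edges H.
Proof.
move=> phi_cov uvE; have /fintype.subsetP := cover_hom phi_cov; apply.
by apply/imsetP; exists (u, v).
Qed.

Lemma cover_surj (G H : graph) (phi : G -> H) : graph_cover phi ->
  forall w : H, exists v : G, phi v = w.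
Proof.
case=> eqE _ w; have [u] := edge_in w.
by rewrite -eqE => /imsetP[[a b] _ [_ ->]]; exists b.
Qed.

(* [levels 0] has one vertex, hence (by [edge_in]) exactly one edge, a loop. *)
Record cover_seq := CoverSeq {
  levels :> nat -> graph;
  bond : forall n, levels n.+1 -> levels n;
  bond_cover : forall n, graph_cover (@bond n);
  level0 : #|levels 0| = 1%N }.

(* phi_(k + m, m) *)
Fixpoint bond_iter (S : cover_seq) (m k : nat) : S (k + m)%N -> S m :=
  match k return S (k + m)%N -> S m with
  | 0 => id
  | j.+1 => fun v => @bond_iter S m j (bond v)
  end.

Section inverse_limit.
Variable S : cover_seq.

Definition threads : set (prod_topology (fun n => discrete_topology (S n))) :=
  [set x | forall n, x n = @bond S n (x n.+1)].

Definition inverse_limit : Type := set_type threads.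

HB.instance Definition _ := Topological.on inverse_limit.

Definition thread_coord (x : inverse_limit) (n : nat) : S n := sval x n.

Lemma thread_coordS (x : inverse_limit) n : thread_coord x n = bond (thread_coord x n.+1).
Proof. by case: x => x /= /set_mem; apply. Qed.

Lemma mk_thread (x : forall n, S n) : (forall n, x n = @bond S n (x n.+1)) ->
  exists y : inverse_limit, forall n, thread_coord y n = x n.
Proof.
move=> xP; have x_in : x \in threads by apply/mem_set.
by exists (exist (fun z => z \in threads) x x_in).
Qed.

Lemma inverse_limit_inhabited : exists x : inverse_limit, True.
Proof.
have /card_gt0P[v0 _] : (0 < #|S 0|)%N by rewrite level0.
pose lift_v n (v : S n) : S n.+1 := projT1 (cid (cover_surj (@bond_cover S n) v)).
pose x := nat_rect (fun n => S n) v0 lift_v.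
have [|y _] := @mk_thread x; last by exists y.
by move=> n /=; rewrite /lift_v; case: cid.
Qed.

HB.instance Definition _ :=
  isPointed.Build inverse_limit (projT1 (cid inverse_limit_inhabited)).

Lemma shift_subproof (x : inverse_limit) : exists y : inverse_limit,
  forall n, (thread_coord x n, thread_coord y n) \in edges (S n).
Proof.
pose w n : S n := projT1 (cid (edge_out (thread_coord x n))).
have wE n : (thread_coord x n, w n) \in edges (S n) by rewrite /w; case: cid.
have stepE n : (thread_coord x n, bond (w n.+1)) \in edges (S n).
  by rewrite thread_coordS; apply: cover_edge (wE _); exact: bond_cover.
have [|y yE] := @mk_thread (fun n => @bond S n (w n.+1)).
  by move=> n; have [_] := @bond_cover S n; apply; [exact: wE|exact: stepE].
by exists y => n; rewrite yE.
Qed.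

Definition shift_map (x : inverse_limit) : inverse_limit :=
  projT1 (cid (shift_subproof x)).

Lemma shift_mapP (x y : inverse_limit) :
  shift_map x = y <-> forall n, (thread_coord x n, thread_coord y n) \in edges (S n).
Proof.
rewrite /shift_map; case: cid => z zE /=; split=> [<- //|yE].
apply/val_inj/functional_extensionality_dep => n.
rewrite -[LHS]/(thread_coord z n) -[RHS]/(thread_coord y n) (thread_coordS z) (thread_coordS y).
by have [_] := @bond_cover S n; apply; [exact: zE|exact: yE].
Qed.

Definition borel := g_sigma_algebraType (@open inverse_limit).

Definition vertex_cylinder n (v : S n) : set inverse_limit :=
  [set x | thread_coord x n = v].

Definition edge_cylinder n (e : edge (S n)) : set inverse_limit :=
  vertex_cylinder (source e) `&` shift_map @^-1` vertex_cylinder (target e).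

End inverse_limit.

Definition shift_invariant (R : realType) (S : cover_seq)
    (mu : probability (borel S) R) : Prop :=
  forall A : set (borel S), measurable A -> mu (@shift_map S @^-1` A) = mu A.

(* Ergodicity of a measure that is assumed to be shift-invariant. *)
Definition ergodic (R : realType) (S : cover_seq)
    (mu : probability (borel S) R) : Prop :=
  forall A : set (borel S), measurable A -> @shift_map S @^-1` A = A ->
    mu A = 0%E \/ mu A = 1%E.

(* R^E; the regular module R^o makes it a vector space over R. *)
Definition edge_space (R : realType) (G : graph) : vectType R :=
  {ffun edge G -> R^o}.

Definition edge_dist (R : realType) (G : graph) (a b : edge_space R G) : R :=
  Num.sqrt (\sum_(e : edge G) (a e - b e) ^+ 2).

Definition edge_weights (R : realType) (S : cover_seq)
    (mu : probability (borel S) R) (n : nat) : edge_space R (S n) :=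
  [ffun e : edge (S n) => fine (mu (edge_cylinder e))].

(* xi_(k + m, m), on the whole of R^E: the coefficient at e' of
   \sum_e a(e) phi(e) is the sum of a(e) over the edges e with phi(e) = e'. *)
Definition push_edges (R : realType) (S : cover_seq) (m k : nat)
    (a : edge_space R (S (k + m)%N)) : edge_space R (S m) :=
  [ffun e' : edge (S m) =>
    \sum_(e : edge (S (k + m)%N) |
      (bond_iter (source e), bond_iter (target e)) == sval e') a e].

(* A circuit is encoded by its edge set, s = [:: v_0; ...; v_(l-1)]. *)
Definition cycle_edges (G : graph) (s : seq G) : {set edge G} :=
  [set e : edge G | (source e \in s) && (next s (source e) == target e)]%SET.

Definition is_circuit (G : graph) (c : {set edge G}) : Prop :=
  exists s : seq G,
    [/\ s != [::], ucycle (fun u v => (u, v) \in edges G) s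
      & c = cycle_edges s].

Definition Circ (G : graph) : {set {set edge G}} :=
  [set c | `[< is_circuit c >]]%SET.

(* The number of edges of a circuit is its length l: see [period_cycle]. *)
Definition period (G : graph) (c : {set edge G}) : nat := #|c|.

Lemma period_cycle (G : graph) (s : seq G) :
  ucycle (fun u v => (u, v) \in edges G) s ->
  period (cycle_edges s) = size s.
Proof.
case/andP=> cyc_s uniq_s.
have inj_src : {in cycle_edges s &, injective (@source G)}.
  move=> e e'; rewrite !finset.inE => /andP[_ /eqP te] /andP[_ /eqP te'] ee'.
  apply: val_inj; change (sval e = sval e').
  rewrite [LHS]surjective_pairing [RHS]surjective_pairing.
  by rewrite -!/(source _) -!/(target _) -te -te' ee'.
rewrite /period -(card_in_imset inj_src) -(card_uniqP uniq_s).
apply: eq_card => u; apply/imsetP/idP => [[e]|us].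
  by rewrite finset.inE => /andP[es _] ->.
exists (exist (fun p => p \in edges G) (u, next s u) (next_cycle cyc_s us));
  by rewrite ?finset.inE /= ?us ?eqxx.
Qed.

Definition circuit_vector (R : realType) (G : graph) (c : {set edge G}) :
    edge_space R G :=
  [ffun e : edge G => (e \in c)%:R].

Definition circuit_mean (R : realType) (G : graph) (c : {set edge G}) :
    edge_space R G :=
  (period c)%:R^-1 *: circuit_vector R c.

Definition circuits_independent (R : realType) (G : graph) : Prop :=
  free [seq circuit_vector R c | c <- enum (Circ G)].

(* Only the values at n in N matter. *)
Definition circuit_family (S : cover_seq) :=
  forall n, {set {set edge (S n)}}.

Definition circuit_system (S : cover_seq) (N : set nat)
    (C : circuit_family S) : Prop :=
  forall n, N n -> C n \subset Circ (S n).

Definition expressed_by (R : realType) (S : cover_seq)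
    (mu : probability (borel S) R) (N : set nat) (C : circuit_family S)
    (s : forall n, {set edge (S n)} -> R) : Prop :=
  forall n, N n ->
    (forall c, c \in C n -> 0 <= s n c) /\
    edge_weights mu n = \sum_(c in C n) s n c *: circuit_mean R c.

(* C(mu, m, n, eps) for n = k + m *)
Definition close_circuits (R : realType) (S : cover_seq)
    (mu : probability (borel S) R) (C : circuit_family S)
    (m k : nat) (eps : R) : {set {set edge (S (k + m)%N)}} :=
  [set c in C (k + m)%N |
    edge_dist (edge_weights mu m) (push_edges (circuit_mean R c)) <= eps]%SET.

(* The limit over n in N, with n = k + m: k tends to infinity along the k
   such that k + m is in N. *)
Definition circuits_concentrate (R : realType) (S : cover_seq)
    (mu : probability (borel S) R) (N : set nat) (C : circuit_family S)
    (s : forall n, {set edge (S n)} -> R) : Prop :=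
  forall m, N m -> forall eps : R, 0 < eps ->
    (fun k => \sum_(c in close_circuits mu C m k eps) s (k + m)%N c)
      @ within [set k | N (k + m)%N] \oo --> (1 : R).

(* Main.v *)
Require Import Defs.
From HB Require Import structures.
From mathcomp Require Import all_boot all_order all_algebra.
From mathcomp Require Import all_classical all_reals all_analysis.
From mathcomp Require Import measurable_realfun lra.

Set Implicit Arguments.
Unset Strict Implicit.
Unset Printing Implicit Defensive.

Import Order.TTheory GRing.Theory Num.Theory.
Import numFieldNormedType.Exports.

Local Open Scope classical_set_scope.
Local Open Scope ring_scope.

(** Ergodicity is compared with concentration one level at a time, through
    explicit estimates on the weights of edges.

    Write q(c) for the proportion of the edges of a circuit c of G_n that lie
    over a fixed edge e of G_m, and p for the mass of U(e), so that q(c) is the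
    e-coordinate of xi_(n,m)(c~) and p that of mu_m.  The s(c) sum to 1, and so
    concentration at level m says that [deviation], the sum of s(c) |q(c) - p|
    over the circuits of C_n, tends to 0 for every e: one implication is
    Markov's inequality ([far_circuits_le]), the other is [deviation_le].

    Ergodic implies concentrated.  Let A_r(x) be the proportion of the first r
    steps of the orbit of x that cross e.  Because covers are deterministic
    forwards, A_r(x) depends only on x_n once n >= m + r ([visits_coord]); it is
    therefore a function on the vertices of G_n, and its mean along a circuit c
    is exactly q(c) ([visits_circuit]).  By Jensen's inequality for the positive
    part, the sum of s(c) (q(c) - p)^+ is at most the integral of (A_r - p)^+,
    uniformly in n, and the ergodic theorem makes this integral small for a
    suitable r.  The numbers q(c) - p have s-mean 0, so their negative parts
    have the same total.  Only an upper bound in probability for the averages of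
    a nonnegative function is needed, which follows from the maximal ergodic
    inequality ([maximal_ergodic], [ergodic_average_upper]).

    Concentrated implies ergodic.  Let A be invariant.  Then mu restricted to A
    and to its complement are invariant, so the masses that they give to the
    edges of G_n are circulations, hence nonnegative combinations of circuits
    ([circulation_decomposition]).  Their sum is mu_n, and when the circuits are
    independent the two decompositions must add up to the given one; so the
    restriction to A puts on each circuit c a mass at most s(c)
    ([invariant_circuit_weights]).  Consequently mu(A & U(e)) differs from
    mu(A) mu(U(e)) by at most the deviation ([invariant_edge_deviation]), which
    can be made arbitrarily small: A is independent of all cylinders, hence of
    all Borel sets, hence of itself, and mu(A) = mu(A)^2. *)

(** * Threads and their orbits *)

Section threads.
Variable S : cover_seq.
Implicit Types x y : inverse_limit S.

Lemma shift_edge x n :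
  (thread_coord x n, thread_coord (shift_map x) n) \in edges (S n).
Proof. by have /shift_mapP := erefl (shift_map x). Qed.

Lemma thread_coord_le x y n m : (m <= n)%N ->
  thread_coord x n = thread_coord y n -> thread_coord x m = thread_coord y m.
Proof.
move=> /subnK; move: (n - m)%N => k; elim: k n => [|k IH] n <- //= xy.
by apply: (IH (k + m)%N) => //; rewrite (thread_coordS x) (thread_coordS y) xy.
Qed.

Lemma thread_bond_iter x m k :
  bond_iter (thread_coord x (k + m)%N) = thread_coord x m.
Proof. by elim: k => //= k <-; rewrite [in RHS]thread_coordS. Qed.

Lemma thread_edge_le x y n m : (m <= n)%N ->
  (thread_coord x n, thread_coord y n) \in edges (S n) ->
  (thread_coord x m, thread_coord y m) \in edges (S m).
Proof.
move=> /subnK; move: (n - m)%N => k; elim: k n => [|k IH] n <- //= xy.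
apply: (IH (k + m)%N) => //; rewrite (thread_coordS x) (thread_coordS y).
by apply: cover_edge xy; exact: bond_cover.
Qed.

(** This is where the second cover condition enters: all edges leaving a vertex
    at level n.+1 have the same target one level below, so any thread z that
    follows y at level n.+1 computes the n-th coordinate of the image of x. *)
Lemma shift_coord x y z n : thread_coord x n.+1 = thread_coord y n.+1 ->
  (thread_coord y n.+1, thread_coord z n.+1) \in edges (S n.+1) ->
  thread_coord (shift_map x) n = thread_coord z n.
Proof.
move=> xy yz; rewrite (thread_coordS (shift_map x)) (thread_coordS z).
have [_] := @bond_cover S n; apply; last exact: yz.
by rewrite -xy; exact: shift_edge.
Qed.

(** Below level n the coordinates are forced; above it each one is chosen in
    the fibre of the preceding one, covers being surjective on vertices. *)
Lemma thread_lift n (v : S n) : exists x, thread_coord x n = v.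
Proof.
have [x [xn xb]] : exists x : forall j, S j,
    x n = v /\ forall j, (j < n)%N -> x j = @bond S j (x j.+1).
  elim: n v => [|n IH] v.
    have [y _] := inverse_limit_inhabited S.
    exists (@dfwith _ (fun j => S j : Type) (thread_coord y) 0 v); split=> //.
    exact: dfwithin.
  have [x [xn xb]] := IH (bond v).
  exists (@dfwith _ (fun j => S j : Type) x n.+1 v); split.
    exact: dfwithin.
  move=> j; rewrite ltnS leq_eqVlt => /predU1P[->|jn].
    have nn : n.+1 != n by rewrite gtn_eqF.
    by rewrite dfwithin dfwithout //.
  have nj : n.+1 != j by rewrite gtn_eqF // ltnS ltnW.
  have nSj : n.+1 != j.+1 by rewrite gtn_eqF // ltnS.
  by rewrite dfwithout // dfwithout // xb.
pose lift_v j (w : S j) : S j.+1 :=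
  projT1 (cid (cover_surj (@bond_cover S j) w)).
pose z := nat_rect (fun j => S j) (x 0)
  (fun j w => if (j < n)%N then x j.+1 else lift_v j w).
have zx j : (j <= n)%N -> z j = x j by case: j => //= j ->.
have zb j : z j = @bond S j (z j.+1).
  rewrite /=; case: ifPn => [jn|_].
    by rewrite zx ?(ltnW jn) // {1}xb.
  by rewrite /lift_v; case: cid.
have [y yz] := mk_thread zb.
by exists y; rewrite yz zx.
Qed.

Definition lift_thread n (v : S n) : inverse_limit S :=
  projT1 (cid (thread_lift v)).

Lemma lift_threadK n (v : S n) : thread_coord (lift_thread v) n = v.
Proof. by rewrite /lift_thread; case: cid. Qed.

(** Each step of the shift costs one level of precision. *)
Lemma iter_shift_coord_le x y n i j : (i + j <= n)%N ->
  thread_coord x n = thread_coord y n ->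
  thread_coord (iter i (@shift_map S) x) j =
  thread_coord (iter i (@shift_map S) y) j.
Proof.
move=> + xy; elim: i j => [|i IH] j ijn; first exact: thread_coord_le xy.
rewrite !iterS; apply: shift_coord (shift_edge _ _).
by apply: IH; rewrite addnS.
Qed.

(** Walks of length i in a level are shadowed, i levels below, by orbits: one
    can compute orbits of threads with walks in the finite graph. *)
Lemma iter_shift_walk n (w : S n -> S n) (v : S n) i j : (i + j <= n)%N ->
  (forall k, (iter k w v, iter k.+1 w v) \in edges (S n)) ->
  thread_coord (iter i (@shift_map S) (lift_thread v)) j =
  thread_coord (lift_thread (iter i w v)) j.
Proof.
move=> + wE; elim: i j => [|i IH] j ijn //.
rewrite iterS; apply: (shift_coord (y := lift_thread (iter i w v))).
  by apply: IH; rewrite addnS.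
apply: (@thread_edge_le _ _ n); first by rewrite (leq_trans _ ijn)// addSn ltnS leq_addl.
by rewrite !lift_threadK.
Qed.

Lemma vertex_cylinder_open n (v : S n) : open (@vertex_cylinder S n v).
Proof.
exists (proj n @^-1` [set v : discrete_topology (S n)]) => //.
apply: open_comp; last exact: discrete_open.
by move=> x _; exact: (@proj_continuous _ (fun n => discrete_topology (S n)) n x).
Qed.

(** The filter generated by the cylinders around x converges coordinatewise, as
    its members eventually fix any given coordinate. *)
Lemma open_cylinder (O : set (inverse_limit S)) x : open O -> O x ->
  exists n, @vertex_cylinder S n (thread_coord x n) `<=` O.
Proof.
move=> [V oV <-] Vx.
pose F : set_system (prod_topology (fun n => discrete_topology (S n))) :=
  [set P | exists n, @vertex_cylinder S n (thread_coord x n) `<=` val @^-1` P].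
have FF : Filter F.
  split; first by exists 0.
    move=> P Q [n nP] [m mQ]; exists (maxn n m) => y yx; split.
      by apply: nP; apply: thread_coord_le yx; rewrite leq_maxl.
    by apply: mQ; apply: thread_coord_le yx; rewrite leq_maxr.
  by move=> P Q PQ [n nP]; exists n => y /nP; exact: PQ.
suff : F --> (val x : prod_topology (fun n => discrete_topology (S n))).
  by apply; apply: open_nbhs_nbhs.
apply/cvg_sup => n; move=> P; rewrite nbhsE => -[Q [[A oA AQ] Qx] QP].
exists n => y yx; apply: QP; rewrite -AQ.
by move: Qx; rewrite -AQ /= /proj -/(thread_coord x n) -/(thread_coord y n) yx.
Qed.

End threads.

(** * A one-sided ergodic theorem *)

Section birkhoff_sums.
Variables (T : Type) (R : realType) (f : T -> T) (h : T -> R).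

Definition birkhoff_sum (k : nat) (x : T) : R :=
  \sum_(i < k) h (iter i f x).

Lemma birkhoff_sumS k x : birkhoff_sum k.+1 x = h x + birkhoff_sum k (f x).
Proof.
rewrite /birkhoff_sum big_ord_recl /=; congr (_ + _).
by apply: eq_bigr => i _; rewrite /= -iterSr.
Qed.

Variable a : R.

(** The maximum over j <= k of the j-th Birkhoff sum of h - a, the empty sum
    included; the recursion takes the maximum one step along the orbit. *)
Fixpoint maximal_sum (k : nat) (x : T) : R :=
  if k is j.+1 then Num.max 0 (h x - a + maximal_sum j (f x)) else 0.

Lemma maximal_sum_ge0 k x : 0 <= maximal_sum k x.
Proof. by case: k => //= k; rewrite le_max lexx. Qed.

Lemma maximal_sum_nd x : {homo maximal_sum ^~ x : i j / (i <= j)%N >-> i <= j}.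
Proof.
apply: homo_leq => [|? ? ?|k]; [exact: lexx|exact: le_trans|].
elim: k x => [|k IH] x; first exact: (maximal_sum_ge0 1).
by rewrite /= le_max2 // lerD2l.
Qed.

Lemma birkhoff_le_maximal k x : birkhoff_sum k x - k%:R * a <= maximal_sum k x.
Proof.
elim: k x => [|k IH] x; first by rewrite /birkhoff_sum big_ord0 mul0r subr0.
rewrite birkhoff_sumS -natr1 /= le_max; apply/orP; right.
have := IH (f x); lra.
Qed.

End birkhoff_sums.

Section maximal_ergodic.
Context d (T : measurableType d) (R : realType) (P : probability T R).
Variable f : T -> T.
Hypothesis f_meas : measurable_fun [set: T] f.
Hypothesis f_inv : forall A, measurable A -> P (f @^-1` A) = P A.

Lemma ge0_integral_invariant (F : T -> \bar R) :
  measurable_fun [set: T] F -> (forall x, 0 <= F x)%E ->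
  (\int[P]_x F (f x) = \int[P]_x F x)%E.
Proof.
move=> mF F0.
rewrite -[LHS](ge0_integral_pushforward f_meas P measurableT) //.
by apply: eq_measure_integral => A mA _ /=; rewrite /pushforward f_inv.
Qed.

Variable h : T -> R.
Hypothesis h_meas : measurable_fun [set: T] h.
Hypothesis h_ge0 : forall x, 0 <= h x.

Local Notation birkhoff_sum := (birkhoff_sum f h).

Lemma birkhoff_sum_meas k : measurable_fun [set: T] (birkhoff_sum k).
Proof.
elim: k => [|k IH].
  rewrite (_ : birkhoff_sum 0 = cst 0); first exact: measurable_cst.
  by apply/funext => x; rewrite /birkhoff_sum big_ord0.
rewrite (_ : birkhoff_sum k.+1 = h \+ (birkhoff_sum k \o f)).
  apply: measurable_funD; first exact: h_meas.
  exact: (measurableT_comp IH f_meas).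
by apply/funext => x; exact: birkhoff_sumS.
Qed.

Variable a : R.

Local Notation maximal_sum := (maximal_sum f h a).

Lemma maximal_sum_meas k : measurable_fun [set: T] (maximal_sum k).
Proof.
elim: k => [|k IH] /=; first exact: measurable_cst.
apply: measurable_maxr; first exact: measurable_cst.
apply: measurable_funD; first by apply: measurable_funB.
exact: measurableT_comp.
Qed.

Lemma maximal_sum_lt_meas k (c : R) : measurable [set x | maximal_sum k x < c].
Proof.
rewrite -[X in measurable X]setTI.
rewrite (_ : [set x | _] = maximal_sum k @^-1` `]-oo, c[%classic).
  exact: (maximal_sum_meas k).
by apply/seteqP; split => x /=; rewrite in_itv.
Qed.

Lemma maximal_sum_le_meas k (c : R) : measurable [set x | maximal_sum k x <= c].
Proof.
rewrite -[X in measurable X]setTI.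
rewrite (_ : [set x | _] = maximal_sum k @^-1` `]-oo, c]%classic).
  exact: (maximal_sum_meas k).
by apply/seteqP; split => x /=; rewrite in_itv.
Qed.

Hypothesis a_gt0 : 0 < a.
Hypothesis h_int : (\int[P]_x (h x)%:E < +oo)%E.

Lemma maximal_sum_int k : (\int[P]_x (maximal_sum k x)%:E < +oo)%E.
Proof.
elim: k => [|k IH] /=; first by rewrite integral0.
apply: (@le_lt_trans _ _ (\int[P]_x ((h x)%:E + (maximal_sum k (f x))%:E))%E).
  apply: ge0_le_integral => //.
  - by move=> x _; rewrite lee_fin le_max lexx.
  - by apply/measurable_EFinP; exact: (maximal_sum_meas k.+1).
  - apply/measurable_EFinP/measurable_funD; first exact: h_meas.
    exact: (measurableT_comp (maximal_sum_meas k) f_meas).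
  - move=> x _; rewrite -EFinD lee_fin ge_max addr_ge0 //=; last exact: maximal_sum_ge0.
    by rewrite lerD2r gerBl ltW.
have mF : measurable_fun setT (fun x => (maximal_sum k x)%:E).
  by apply/measurable_EFinP; exact: maximal_sum_meas.
rewrite ge0_integralD //; last 4 first.
- by move=> x _; rewrite lee_fin.
- exact/measurable_EFinP.
- by move=> x _; rewrite lee_fin maximal_sum_ge0.
- exact: (measurableT_comp mF f_meas).
rewrite (@ge0_integral_invariant (fun x => (maximal_sum k x)%:E)) //.
  by rewrite lte_add_pinfty.
by move=> x; rewrite lee_fin maximal_sum_ge0.
Qed.

(** Compare the maximal sum at x after k+1 steps with the one at f x after k
    steps.  Where the latter is at least a, the maximum defining the former is
    attained by its second argument, because h >= 0, and the difference is
    exactly h - a; elsewhere the difference is at most h.  So on the whole it is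
    bounded by h - a plus a times the indicator of the preimage under f of
    [maximal_sum k < a].  Its integral is nonnegative because f preserves P and
    maximal sums increase with k. *)
Lemma maximal_ergodic k :
  (a%:E <= \int[P]_x (h x)%:E + a%:E * P [set x | (maximal_sum k x < a)%R])%E.
Proof.
set L := [set x | maximal_sum k x < a].
have mL : measurable L := maximal_sum_lt_meas k a.
have mF j : measurable_fun setT (fun x => (maximal_sum j x)%:E).
  by apply/measurable_EFinP; exact: maximal_sum_meas.
have mFf j : measurable_fun setT (fun x => (maximal_sum j (f x))%:E).
  exact: (measurableT_comp (mF j) f_meas).
have mI : measurable_fun setT (fun x => (a * \1_L x)%:E).
  apply/measurable_EFinP/measurable_funM; first exact: measurable_cst.
  exact: measurable_indic.
have mIf : measurable_fun setT (fun x => (a * \1_L (f x))%:E).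
  exact: (measurableT_comp mI f_meas).
have mh : measurable_fun setT (fun x => (h x)%:E) by apply/measurable_EFinP.
have I0 x : (0 <= (a * \1_L x)%:E)%E.
  by rewrite lee_fin mulr_ge0 // ltW.
have F0 j x : (0 <= (maximal_sum j x)%:E)%E by rewrite lee_fin maximal_sum_ge0.
have h0 x : (0 <= (h x)%:E)%E by rewrite lee_fin.
have IE : (\int[P]_x (a * \1_L (f x))%:E = a%:E * P L)%E.
  rewrite (@ge0_integral_invariant (fun x => (a * \1_L x)%:E)) //.
  under eq_integral do rewrite EFinM.
  rewrite ge0_integralZl_EFin ?ltW //.
  - by rewrite integral_indic // setIT.
  - by apply/measurable_EFinP; exact: measurable_indic.
have cstE : (\int[P]_(_ in setT) a%:E = a%:E)%E.
  by rewrite (@integral_cst _ _ _ P setT) // [X in (_ * X)%E](probability_setT P) mule1.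
have FE : (\int[P]_x (maximal_sum k (f x))%:E =
           \int[P]_x (maximal_sum k x)%:E)%E.
  by rewrite (@ge0_integral_invariant (fun x => (maximal_sum k x)%:E)).
have le1 : (\int[P]_x ((maximal_sum k.+1 x)%:E + a%:E) <=
    \int[P]_x ((maximal_sum k (f x))%:E + ((h x)%:E + (a * \1_L (f x))%:E)))%E.
  apply: ge0_le_integral => //.
  - by move=> x _; apply: adde_ge0 => //; rewrite lee_fin ltW.
  - by apply: emeasurable_funD.
  - by apply: emeasurable_funD => //; exact: emeasurable_funD.
  - move=> x _; rewrite -!EFinD lee_fin /=.
    have := maximal_sum_ge0 f h a k (f x); have := h_ge0 x.
    have [fL|fL] := ltP (maximal_sum k (f x)) a.
      rewrite indicE mem_set // mulr1 => hx Fx.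
      by rewrite addrA lerD2r ge_max addr_ge0 //= addrC; lra.
    rewrite indicE memNset; last by rewrite /L /= ltNge fL.
    rewrite mulr0 addr0 => hx Fx.
    by rewrite -lerBrDr ge_max; apply/andP; split; lra.
rewrite (@ge0_integralD _ _ _ P setT) // in le1; last by move=> x _; rewrite lee_fin ltW.
rewrite ge0_integralD // in le1; last first.
- by apply: emeasurable_funD.
- by move=> x _; rewrite !adde_ge0.
rewrite ge0_integralD // in le1.
rewrite FE IE cstE in le1.
have Ffin : (\int[P]_x (maximal_sum k x)%:E \is a fin_num)%E.
  by rewrite ge0_fin_numE ?maximal_sum_int // integral_ge0.
rewrite -(@leeD2lE _ _ _ _ Ffin); apply: le_trans le1; apply: leeD2r.
apply: ge0_le_integral => // x _; rewrite lee_fin.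
exact: (maximal_sum_nd f h a x (leqnSn k)).
Qed.

End maximal_ergodic.

Section ergodic_averages.
Context d (T : measurableType d) (R : realType) (P : probability T R).
Variable f : T -> T.
Hypothesis f_meas : measurable_fun [set: T] f.
Hypothesis f_inv : forall A, measurable A -> P (f @^-1` A) = P A.
Hypothesis f_erg : forall A, measurable A -> f @^-1` A = A ->
  P A = 0%E \/ P A = 1%E.
Variable h : T -> R.
Hypothesis h_meas : measurable_fun [set: T] h.
Hypothesis h_ge0 : forall x, 0 <= h x.

Let bounded_by (a : R) (M : nat) : set T :=
  \bigcap_k [set x | maximal_sum f h a k x <= M%:R].

Let bounded_by_meas a M : measurable (bounded_by a M).
Proof. by apply: bigcapT_measurable => k; exact: maximal_sum_le_meas. Qed.

(** Boundedness of the Birkhoff sums of a point is unaffected by dropping or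
    adding one term; the invariance is strict, not only almost everywhere. *)
Lemma maximal_bounded_invariant (a : R) :
  f @^-1` (\bigcup_M bounded_by a M) = \bigcup_M bounded_by a M.
Proof.
apply/seteqP; split => x [M _ xM].
- exists (Num.truncn (`|h x - a| + M%:R)).+1 => // k _.
  have ltM := truncnS_gt (`|h x - a| + M%:R).
  apply: le_trans (ltW ltM).
  case: k => [|k] /=; first by rewrite addr_ge0.
  have /= xk := xM k Logic.I; rewrite ge_max addr_ge0 //=.
  by rewrite lerD // ler_norm.
- exists (Num.truncn (`|a - h x| + M%:R)).+1 => // k _.
  have ltM := truncnS_gt (`|a - h x| + M%:R).
  apply: le_trans (ltW ltM).
  have /= := xM k.+1 Logic.I; rewrite ge_max => /andP[_ xk].
  have := ler_norm (a - h x); lra.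
Qed.

(** The maximal inequality gives the points where the sums stay below a
    probability at least (a - I) / a, with I the integral of h, so the invariant
    set of points with bounded sums is not null and ergodicity makes it full. *)
Lemma maximal_bounded_full (a : R) : (\int[P]_x (h x)%:E < a%:E)%E ->
  P (\bigcup_M bounded_by a M) = 1%E.
Proof.
move=> ha.
have I0 : (0 <= \int[P]_x (h x)%:E)%E by apply: integral_ge0 => x _; rewrite lee_fin.
have Ifin : (\int[P]_x (h x)%:E)%E \is a fin_num.
  by rewrite ge0_fin_numE // (lt_trans ha) // ltry.
have a_gt0 : 0 < a by rewrite -lte_fin (le_lt_trans I0).
have mB : measurable (\bigcup_M bounded_by a M) by exact: bigcupT_measurable.
have [PB0|//] := f_erg mB (maximal_bounded_invariant a).
(* If it were null, so would be the smaller set where the sums stay below a. *)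
pose L k := [set x | maximal_sum f h a k x < a].
have mL k : measurable (L k) by exact: maximal_sum_lt_meas.
have mLL : measurable (\bigcap_k L k) by exact: bigcapT_measurable.
have PL0 : P (\bigcap_k L k) = 0%E.
  apply: (subset_measure0 _ _ _ PB0) => //.
  move=> x xL; exists (Num.truncn a).+1 => // k _ /=.
  exact: ltW (lt_trans (xL k Logic.I) (truncnS_gt a)).
have Lni : nonincreasing_seq L.
  move=> i j ij; apply/subsetPset => x; rewrite /L /=; apply: le_lt_trans.
  exact: maximal_sum_nd.
have Lcvg : P \o L @ \oo --> 0%E.
  rewrite -PL0; apply: nonincreasing_cvg_mu => //.
  by rewrite (le_lt_trans (probability_le1 _ _)) // ltry.
pose I := fine (\int[P]_x (h x)%:E)%E.
have IE : (\int[P]_x (h x)%:E)%E = I%:E by rewrite fineK.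
have Ia : I < a by rewrite -lte_fin -IE.
have PLge k : (((a - I) / a)%:E <= (P \o L) k)%E.
  have := maximal_ergodic f_meas f_inv h_meas h_ge0 a_gt0 (lt_trans ha (ltry a)) k.
  rewrite IE -/(L k) /=.
  have /fineK <- : P (L k) \is a fin_num by apply: fin_num_measure.
  by rewrite -EFinM -EFinD !lee_fin ler_pdivrMr // => ?; lra.
have : (((a - I) / a)%:E <= 0)%E.
  rewrite -(cvg_lim _ Lcvg) //; apply: lime_ge.
    by apply/cvg_ex; eexists; exact: Lcvg.
  by apply: nearW.
by rewrite lee_fin leNgt divr_gt0 // subr_gt0.
Qed.

(** Take a halfway between the integral of h and b.  Outside an event of small
    probability the sums of h - a are all at most some M, whereas the k-th
    average of h exceeds b only if the k-th sum of h - a exceeds k (b - a). *)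
Theorem ergodic_average_upper (b : R) (eps : R) : 0 < eps ->
  (\int[P]_x (h x)%:E < b%:E)%E ->
  \forall k \near \oo,
    (P [set x | (k%:R * b < birkhoff_sum f h k x)%R] <= eps%:E)%E.
Proof.
move=> eps0 hb.
have I0 : (0 <= \int[P]_x (h x)%:E)%E by apply: integral_ge0 => x _; rewrite lee_fin.
have Ifin : (\int[P]_x (h x)%:E)%E \is a fin_num.
  by rewrite ge0_fin_numE // (lt_trans hb) // ltry.
pose I := fine (\int[P]_x (h x)%:E)%E.
have IE : (\int[P]_x (h x)%:E)%E = I%:E by rewrite fineK.
have Ib : I < b by rewrite -lte_fin -IE.
pose a := (I + b) / 2.
have ha : (\int[P]_x (h x)%:E < a%:E)%E by rewrite IE lte_fin /a; lra.
have Bcvg : P \o bounded_by a @ \oo --> 1%E.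
  rewrite -(maximal_bounded_full ha); apply: nondecreasing_cvg_mu => //.
    exact: bigcupT_measurable.
  move=> i j ij; apply/subsetPset => x xi k _; apply: le_trans (xi k Logic.I) _.
  by rewrite ler_nat.
have : fine \o (P \o bounded_by a) @ \oo --> (1 : R) by exact: fine_cvg Bcvg.
move=> /cvgr_gt /(_ (1 - eps)) -/(_ _)[|M _ /(_ M (leqnn M)) /= PM]; first lra.
have [K KM] : exists K : nat, M%:R / (b - a) <= K%:R.
  by exists (Num.truncn (M%:R / (b - a))).+1; exact/ltW/truncnS_gt.
have ba : 0 < b - a by rewrite /a; lra.
exists K => // k /= Kk.
have mS : measurable [set x | (k%:R * b < birkhoff_sum f h k x)%R].
  rewrite -[X in measurable X]setTI.
  rewrite (_ : [set x | _] = birkhoff_sum f h k @^-1` `]k%:R * b, +oo[%classic).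
    exact: (birkhoff_sum_meas f_meas h_meas).
  by apply/seteqP; split => x /=; rewrite in_itv /= andbT.
apply: (@le_trans _ _ (P (~` bounded_by a M))).
  apply: le_measure; rewrite ?inE //; first exact: measurableC.
  move=> x /= xb /(_ k Logic.I) /=.
  have := birkhoff_le_maximal f h a k x.
  have : M%:R <= k%:R * (b - a).
    by rewrite -ler_pdivrMr // (le_trans KM) // ler_nat.
  lra.
rewrite probability_setC //.
have /fineK <- : P (bounded_by a M) \is a fin_num by apply: fin_num_measure.
rewrite -EFinB lee_fin; lra.
Qed.

End ergodic_averages.

(** * Cylinders generate the Borel sets *)

Section finite_fibres.
Context d (T : measurableType d) (R : realType) (P : probability T R).
Variables (I : finType) (p : T -> I).
Hypothesis p_meas : forall i, measurable (p @^-1` [set i]).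

Lemma fibres_measurable (Q : pred I) : measurable [set x | Q (p x)].
Proof.
rewrite (_ : [set x | _] = \bigcup_(i in [set` Q]) p @^-1` [set i]).
  by apply: fin_bigcup_measurable => //; exact: finite_finpred.
by apply/seteqP; split => x /= => [Qx|[i Qi /= ->]]; [exists (p x)|].
Qed.

Lemma sum_fibres (A : set T) (Q : pred I) : measurable A ->
  \sum_(i | Q i) fine (P (A `&` p @^-1` [set i])) =
  fine (P (A `&` [set x | Q (p x)])).
Proof.
move=> mA.
have -> : A `&` [set x | Q (p x)] =
    A `&` [set x | (p x \in index_enum I) && Q (p x)].
  by apply/seteqP; split=> x /=; rewrite mem_index_enum.
elim: (index_enum I) (index_enum_uniq I) => [_|i s IH /= /andP[si us]].
  rewrite big_nil (_ : _ `&` _ = set0) ?measure0 //.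
  by apply/seteqP; split => x //= -[].
rewrite big_cons; case: ifPn => [Qi|nQi]; last first.
  rewrite IH //; congr (fine (P _)); apply/seteqP; split => x /= [Ax].
    by move=> /andP[xs ->]; rewrite inE xs orbT.
  rewrite inE => /andP[/predU1P[->|-> ->//]]; by rewrite (negbTE nQi).
rewrite IH // -fineD; last 2 first.
- by apply: fin_num_measure; apply: measurableI.
- apply: fin_num_measure; apply: measurableI => //.
  exact: (fibres_measurable (fun i => (i \in s) && Q i)).
rewrite -measureU; last 3 first.
- exact: measurableI.
- apply: measurableI => //.
  exact: (fibres_measurable (fun i => (i \in s) && Q i)).
- apply/seteqP; split => x //= [[_ pxi] [_]].
  by rewrite pxi (negbTE si).
congr (fine (P _)); apply/seteqP; split => x /=.
  move=> [[Ax ->]|[Ax /andP[xs ->]]]; first by rewrite inE eqxx Qi.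
  by rewrite inE xs orbT.
move=> [Ax]; rewrite inE => /andP[/predU1P[pxi|xs] Qx]; first by left.
by right; rewrite xs.
Qed.

End finite_fibres.

Section cylinders.
Variable S : cover_seq.
Implicit Types x y : inverse_limit S.

Lemma cylinder_open (O : set (inverse_limit S)) :
  (forall x, O x -> exists n, @vertex_cylinder S n (thread_coord x n) `<=` O) ->
  open O.
Proof.
move=> cylO.
rewrite (_ : O = \bigcup_(nv in [set nv : {n & S n} |
    @vertex_cylinder S (projT1 nv) (projT2 nv) `<=` O])
    @vertex_cylinder S (projT1 nv) (projT2 nv)).
  by apply: bigcup_open => nv _; exact: vertex_cylinder_open.
apply/seteqP; split => [x Ox|x [nv nvO /nvO]//].
have [n nO] := cylO x Ox; exists (existT _ n (thread_coord x n)) => //.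
Qed.

(** Coordinate n of the image depends only on coordinate n.+1 of the point. *)
Lemma shift_open (O : set (inverse_limit S)) :
  open O -> open (@shift_map S @^-1` O).
Proof.
move=> oO; apply: cylinder_open => x /= /(open_cylinder oO)[n nO].
exists n.+1 => y yx; apply: nO; rewrite /vertex_cylinder /=.
exact: shift_coord yx (shift_edge x n.+1).
Qed.

Lemma shift_measurable :
  measurable_fun [set: borel S] (@shift_map S : borel S -> borel S).
Proof.
apply: (measurability _ (erefl : @measurable _ (borel S) = <<s open >>)).
move=> _ [V oV <-]; rewrite setTI; apply: sub_sigma_algebra.
exact: shift_open.
Qed.

Lemma vertex_cylinder_measurable n (v : S n) :
  measurable (@vertex_cylinder S n v : set (borel S)).
Proof. by apply: sub_sigma_algebra; exact: vertex_cylinder_open. Qed.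

Lemma shift_preimage_measurable (A : set (borel S)) :
  measurable A -> measurable (@shift_map S @^-1` A : set (borel S)).
Proof.
by move=> mA; rewrite -[X in measurable X]setTI; exact: shift_measurable.
Qed.

Lemma edge_cylinder_measurable n (e : edge (S n)) :
  measurable (edge_cylinder e : set (borel S)).
Proof.
apply: measurableI; first exact: vertex_cylinder_measurable.
exact: (shift_preimage_measurable (vertex_cylinder_measurable (target e))).
Qed.

(** The edge of level n that a thread crosses under the shift; its fibres are
    the edge cylinders, which turns sums over edges into measures of sets. *)
Definition edge_at n (x : borel S) : edge (S n) :=
  exist (fun p => p \in edges (S n)) _ (shift_edge x n).

Lemma edge_at_fibre n (e : edge (S n)) :
  @edge_at n @^-1` [set e] = edge_cylinder e.
Proof.
apply/seteqP; split => [x /= <-//|x [/= xs xt]].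
apply: val_inj => /=; rewrite [RHS]surjective_pairing.
by congr (_, _).
Qed.

Lemma edge_at_measurable n (e : edge (S n)) :
  measurable (@edge_at n @^-1` [set e]).
Proof. by rewrite edge_at_fibre; exact: edge_cylinder_measurable. Qed.

(** The empty set makes the family stable under intersection. *)
Definition cylinders : set (set (borel S)) :=
  [set A | A = set0 \/ exists n (v : S n), A = vertex_cylinder v].

(** Countability matters here: an open set is the union, over the levels, of the
    finitely many cylinders of that level that it contains. *)
Lemma measurable_cylinders : @measurable _ (borel S) = <<s cylinders >>.
Proof.
apply/seteqP; split; apply: smallest_sub; try exact: smallest_sigma_algebra.
  move=> O oO.
  rewrite (_ : O = \bigcup_n \bigcup_(v in [set v : S n | vertex_cylinder v `<=` O])
      vertex_cylinder v).
    apply: (@bigcupT_measurable _ (g_sigma_algebraType cylinders)) => n.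
    apply: (@fin_bigcup_measurable _ (g_sigma_algebraType cylinders)) => [|v _].
      exact: finite_finset.
    by apply: sub_sigma_algebra; right; exists n, v.
  apply/seteqP; split => [x Ox|x [n _ [v vO /vO]]//].
  have [n nO] := open_cylinder oO Ox.
  by exists n => //; exists (thread_coord x n).
move=> A [->|[n [v ->]]]; first exact: sigma_algebra0.
exact: vertex_cylinder_measurable.
Qed.

(** Cylinders are nested or disjoint. *)
Lemma cylinders_setI : setI_closed cylinders.
Proof.
suff cylI n m (v : S n) (w : S m) : (n <= m)%N ->
    vertex_cylinder v `&` vertex_cylinder w = set0 \/
    vertex_cylinder v `&` vertex_cylinder w = vertex_cylinder w.
  move=> A B [->|[n [v ->]]]; first by rewrite set0I; left.
  move=> [->|[m [w ->]]]; first by rewrite setI0; left.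
  have [nm|mn] := leqP n m.
    by have [->|->] := cylI _ _ v w nm; [left|right; exists m, w].
  rewrite setIC.
  by have [->|->] := cylI _ _ w v (ltnW mn); [left|right; exists n, v].
move=> nm; have [vw|vw] := eqVneq (thread_coord (lift_thread w) n) v.
  right; apply/setIidPr => x xw /=; rewrite /vertex_cylinder /= -vw.
  by apply: (thread_coord_le nm); rewrite lift_threadK.
left; apply/seteqP; split => x //= [xv xw]; move/eqP: vw; apply.
by rewrite -xv; apply: (thread_coord_le nm); rewrite lift_threadK.
Qed.

End cylinders.

(** * Circuits and circulations of a finite graph *)

Section circuits.
Variables (R : realType) (G : graph).
Implicit Types (c : {set edge G}) (a : edge G -> R) (s : seq G).

Lemma edge_ext (e e' : edge G) :
  source e = source e' -> target e = target e' -> e = e'.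
Proof.
move=> ee' te; apply: val_inj => /=.
by rewrite [LHS]surjective_pairing [RHS]surjective_pairing; congr (_, _).
Qed.

Lemma sum_cycle_edges s (F : G -> G -> R) :
  ucycle (fun u v => (u, v) \in edges G) s ->
  \sum_(e in cycle_edges s) F (source e) (target e) =
  \sum_(v in s) F v (next s v).
Proof.
move=> /andP[cyc_s uniq_s].
have inj_src : {in cycle_edges s &, injective (@source G)}.
  move=> e e'; rewrite !finset.inE => /andP[_ /eqP te] /andP[_ /eqP te'] ee'.
  by apply: edge_ext => //; rewrite -te -te' ee'.
transitivity (\sum_(v in [set source e | e in cycle_edges s]%SET) F v (next s v)).
  rewrite (big_imset (fun v => F v (next s v)) inj_src) /=; apply: eq_bigr => e.
  by rewrite finset.inE => /andP[_ /eqP ->].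
apply: eq_bigl => u; apply/imsetP/idP => [[e]|us].
  by rewrite finset.inE => /andP[es _] ->.
exists (exist (fun p => p \in edges G) (u, next s u) (next_cycle cyc_s us));
  by rewrite ?finset.inE /= ?us ?eqxx.
Qed.

(** The successor map of a duplicate-free cycle permutes its vertices. *)
Lemma sum_next s (F : G -> R) : uniq s ->
  \sum_(v in s) F (next s v) = \sum_(v in s) F v.
Proof.
move=> us; rewrite [RHS](reindex_inj (can_inj (prev_next us))).
by apply: eq_bigl => v; rewrite mem_next.
Qed.

Lemma sum_iter_next s (F : G -> R) i : uniq s ->
  \sum_(v in s) F (iter i (next s) v) = \sum_(v in s) F v.
Proof.
move=> us; elim: i F => [//|i IH] F.
by rewrite /= (IH (fun v => F (next s v))) sum_next.
Qed.

(** Kirchhoff's law. *)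
Definition circulation a := forall v : G,
  \sum_(e | source e == v) a e = \sum_(e | target e == v) a e.

Lemma circuit_circulation c : is_circuit c ->
  circulation (fun e => (e \in c)%:R).
Proof.
case=> s [_ cyc_s ->] v; have us : uniq s by case/andP: cyc_s.
transitivity (\sum_(e in cycle_edges s) (source e == v)%:R : R).
  rewrite big_mkcond [RHS]big_mkcond; apply: eq_bigr => e _.
  by case: (e \in _); case: (_ == v).
transitivity (\sum_(e in cycle_edges s) (target e == v)%:R : R); last first.
  rewrite big_mkcond [RHS]big_mkcond; apply: eq_bigr => e _.
  by case: (e \in _); case: (_ == v).
rewrite (sum_cycle_edges (fun u w => (u == v)%:R)) //.
rewrite (sum_cycle_edges (fun u w => (w == v)%:R)) //.
by rewrite (sum_next (fun w => (w == v)%:R)).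
Qed.

(** By conservation, a vertex entered by an edge of positive weight is also left
    by one.  Following such edges in a finite graph ends in a cycle. *)
Lemma circulation_has_circuit a (e0 : edge G) :
  (forall e, 0 <= a e) -> circulation a -> 0 < a e0 ->
  exists c, [/\ is_circuit c, exists e, e \in c & forall e, e \in c -> 0 < a e].
Proof.
move=> a_ge0 a_circ e0_gt0.
(* [out v] is an edge of positive weight leaving v, and g follows it. *)
pose out v := [pick e : edge G | (source e == v) && (0 < a e)].
pose g v := if out v is Some e then target e else v.
have out_some e : 0 < a e ->
    exists2 e', out (target e) = Some e' & (source e' == target e) && (0 < a e').
  move=> ae; rewrite /out; case: pickP => [e' e'P|noe]; first by exists e'.
  have : 0 < \sum_(e' | source e' == target e) a e'.
    rewrite a_circ (bigD1 e) //= ltr_pwDl // sumr_ge0 // => *; exact: a_ge0.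
  rewrite big1 ?ltxx // => e' e's; apply/eqP; rewrite eq_le a_ge0 andbT leNgt.
  by have := noe e'; rewrite e's /= => ->.
pose v0 := target e0.
have out_iter k : exists2 e, out (iter k g v0) = Some e &
    (source e == iter k g v0) && (0 < a e).
  elim: k => [|k [e oe /andP[/eqP se ae]]]; first exact: out_some.
  by rewrite iterS {1 3}/g oe; exact: out_some.
(* The orbit of v0 returns to w, one of its points, which is thus on a cycle. *)
have /trajectP[i ik wE] := looping_order g v0.
set w := iter i g v0 in wE.
have cyc_w : fcycle g (orbit g w).
  apply/(orbitPcycle 0 3); exists (order g v0 - i).-1.
  by rewrite prednK ?subn_gt0 // {1}/w -iterD subnK ?(ltnW ik).
set s := orbit g w in cyc_w.
have us : uniq s by exact: orbit_uniq.
have s_out u : u \in s -> exists2 e, out u = Some e &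
    [&& source e == u, target e == next s u & 0 < a e].
  move=> su; move: (su); rewrite -fconnect_orbit => /iter_findex.
  rewrite /w -iterD => uE; have := out_iter (findex g w u + i)%N.
  rewrite uE => -[e oe /andP[se ae]]; exists e => //.
  by rewrite se ae (nextE cyc_w su) /g oe eqxx.
have cyc_s : ucycle (fun u v => (u, v) \in edges G) s.
  rewrite /ucycle us andbT; apply: cycle_from_next => // u /s_out[e _].
  by move=> /and3P[/eqP <- /eqP <- _]; case: e => -[].
exists (cycle_edges s); split.
- by exists s; split=> //; rewrite -size_eq0 size_orbit -lt0n order_gt0.
- have /s_out[e _ /and3P[/eqP se /eqP te _]] : w \in s by exact: in_orbit.
  by exists e; rewrite finset.inE te se eqxx in_orbit.
- move=> e; rewrite finset.inE => /andP[/s_out[e' _ /and3P[/eqP se /eqP te ae]] /eqP ne].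
  by rewrite (@edge_ext e e') // -?ne ?te.
Qed.

(** Subtract from a circulation the largest multiple of a circuit in its support
    that keeps it nonnegative: the support loses an edge, whence an induction on
    its cardinal. *)
Lemma circulation_decomposition a : (forall e, 0 <= a e) -> circulation a ->
  exists2 t : {set edge G} -> R, (forall c, 0 <= t c) &
    forall e, a e = \sum_(c in Circ G) t c * (e \in c)%:R.
Proof.
have [n] := ubnP #|[pred e | a e != 0]|; elim: n => // n IH in a *.
move=> an a_ge0 a_circ.
have [/existsP[e0 ae0]|/existsPn a0] := boolP [exists e, a e != 0]; last first.
  exists (fun => 0) => // e; have := a0 e; rewrite negbK => /eqP ->.
  by rewrite big1 // => c _; rewrite mul0r.
have {}ae0 : 0 < a e0 by rewrite lt_def ae0 a_ge0.
have [c [cC [e1 e1c] c_gt0]] := circulation_has_circuit a_ge0 a_circ ae0.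
case: (arg_minP (fun e => a e) e1c) => e2 e2c' e2_min.
have e2c : e2 \in c := e2c'.
pose a' e := a e - a e2 * (e \in c)%:R.
have a'_ge0 e : 0 <= a' e.
  rewrite /a'; case: (boolP (e \in c)) => [ec|_]; last by rewrite mulr0 subr0.
  by rewrite mulr1 subr_ge0 e2_min.
have a'_circ : circulation a'.
  move=> v; rewrite /a' !sumrB -!mulr_sumr a_circ; congr (_ - _ * _).
  exact: circuit_circulation.
have a'n : (#|[pred e | (a' e != 0)%R]| < n)%N.
  rewrite -ltnS (leq_trans _ an) // ltnS; apply: proper_card.
  apply/properP; split.
    apply/fintype.subsetP => e; rewrite !inE; apply: contraNN => /eqP ae.
    rewrite /a' ae; case: (boolP (e \in c)) => [/c_gt0|_].
      by rewrite ae ltxx.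
    by rewrite mulr0 subr0.
  exists e2; rewrite !inE; first by rewrite gt_eqF ?c_gt0.
  by rewrite /a' e2c mulr1 subrr eqxx.
have [t t_ge0 tE] := IH _ a'n a'_ge0 a'_circ.
exists (fun d => t d + a e2 * (d == c)%:R).
  by move=> d; rewrite addr_ge0 // mulr_ge0.
move=> e; under eq_bigr do rewrite mulrDl.
rewrite big_split /= -tE (bigD1 c) /=; last by rewrite finset.inE; apply/asboolP.
rewrite big1 ?eqxx => [|d /andP[_ /negbTE ->]]; last by rewrite mulr0 mul0r.
by rewrite /a' mulr1 addr0 subrK.
Qed.

Lemma circuits_independent_eq0 (t : {set edge G} -> R) :
  circuits_independent R G ->
  (forall e, \sum_(c in Circ G) t c * (e \in c)%:R = 0) ->
  forall c, c \in Circ G -> t c = 0.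
Proof.
move=> indep t0 c cC.
pose X := [seq circuit_vector R c | c <- enum (Circ G)].

have /(freeP (X := in_tuple X)) := indep.
have ic : (index c (enum (Circ G)) < size X)%N.
  by rewrite size_map index_mem mem_enum.
move=> /(_ (fun i => t (nth finset.set0 (enum (Circ G)) i)) _ (Ordinal ic)) /=.
rewrite nth_index ?mem_enum //; apply.
transitivity (\sum_(c in Circ G) t c *: circuit_vector R c); last first.
  apply/ffunP => e; rewrite sum_ffunE !ffunE -[RHS](t0 e).
  by apply: eq_bigr => d _; rewrite !ffunE.
rewrite -[RHS]big_enum /= (big_nth finset.set0) -(size_map (@circuit_vector R G)).
rewrite big_mkord; apply: eq_bigr => i _; rewrite (nth_map finset.set0) //.
by rewrite -(size_map (@circuit_vector R G)).
Qed.

End circuits.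

(** * Edge masses, and the deviation of a system of circuits *)

Section edge_masses.
Variables (R : realType) (S : cover_seq) (mu : probability (borel S) R).

Definition edge_mass (A : set (borel S)) n (e : edge (S n)) : R :=
  fine (mu (A `&` edge_cylinder e)).

Lemma edge_mass_ge0 A n (e : edge (S n)) : 0 <= edge_mass A e.
Proof. exact/fine_ge0/measure_ge0. Qed.

Lemma edge_weightsE n (e : edge (S n)) : edge_weights mu n e = edge_mass setT e.
Proof. by rewrite /edge_mass ffunE setTI. Qed.

Lemma sum_edge_mass A n (Q : pred (edge (S n))) : measurable A ->
  \sum_(e | Q e) edge_mass A e = fine (mu (A `&` [set x | Q (edge_at n x)])).
Proof.
move=> mA; rewrite -(sum_fibres mu (@edge_at_measurable S n)) //.
by apply: eq_bigr => e _; rewrite edge_at_fibre.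
Qed.

Lemma sum_edge_massT A n : measurable A ->
  \sum_(e : edge (S n)) edge_mass A e = fine (mu A).
Proof.
move=> mA; rewrite sum_edge_mass //; congr (fine (mu _)).
by apply/seteqP; split => x // [].
Qed.

Lemma sum_edge_mass_source A n (v : S n) : measurable A ->
  \sum_(e | source e == v) edge_mass A e = fine (mu (A `&` vertex_cylinder v)).
Proof.
move=> mA; rewrite (sum_edge_mass (fun e => source e == v)) //.
congr (fine (mu (_ `&` _))); apply/seteqP.
by split=> x /= => [/eqP|<-]; [|apply/eqP].
Qed.

Lemma push_edge_mass A m k (e' : edge (S m)) : measurable A ->
  \sum_(e : edge (S (k + m)%N) |
    (bond_iter (source e), bond_iter (target e)) == sval e') edge_mass A e =
  edge_mass A e'.
Proof.
move=> mA.
rewrite (sum_edge_mass (fun e =>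
  (bond_iter (source e), bond_iter (target e)) == sval e')) //.
rewrite /edge_mass -edge_at_fibre; congr (fine (mu (_ `&` _))).
apply/seteqP; split => x /=; rewrite /source /target /= !thread_bond_iter.
  by move=> /eqP xe; apply: val_inj.
by move=> <-.
Qed.

Hypothesis mu_inv : shift_invariant mu.

(** Outflow and inflow at v are the masses, within A, of U(v) and of its
    preimage under the shift. *)
Lemma edge_mass_circulation (A : set (borel S)) n :
  measurable A -> @shift_map S @^-1` A = A ->
  circulation (@edge_mass A n).
Proof.
move=> mA iA v; rewrite sum_edge_mass_source //.
rewrite (sum_edge_mass (fun e => target e == v)) //; congr fine.
rewrite -mu_inv; last first.
  by apply: measurableI => //; exact: vertex_cylinder_measurable.
rewrite preimage_setI iA; congr (mu (_ `&` _)); apply/seteqP.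
by split=> x /= => [<-|/eqP]; [apply/eqP|].
Qed.

End edge_masses.

Section circuit_means.
Variables (R : realType) (S : cover_seq).

Lemma period_gt0 (G : graph) (c : {set edge G}) : is_circuit c ->
  0 < (period c)%:R :> R.
Proof.
by case=> s [s0 cyc_s ->]; rewrite period_cycle // ltr0n lt0n size_eq0.
Qed.

Lemma sum_circuit_mean (G : graph) (c : {set edge G}) (q : edge G -> R) :
  \sum_e circuit_mean R c e * q e = (period c)%:R^-1 * \sum_(e in c) q e.
Proof.
rewrite mulr_sumr [RHS]big_mkcond; apply: eq_bigr => e _.
rewrite !ffunE -[_ *: _]/(_ * _) -mulrA; case: (e \in c).
  by rewrite mul1r.
by rewrite mul0r mulr0.
Qed.

Lemma push_circuit_mean m k (c : {set edge (S (k + m)%N)}) (e' : edge (S m)) :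
  push_edges (circuit_mean R c) e' = (period c)%:R^-1 *
  \sum_(e in c) ((bond_iter (source e), bond_iter (target e)) == sval e')%:R.
Proof.
rewrite -sum_circuit_mean ffunE big_mkcond; apply: eq_bigr => e _.
by case: (_ == _); rewrite ?mulr1 ?mulr0.
Qed.

Lemma push_circuit_mean_ge0 m k (c : {set edge (S (k + m)%N)}) (e' : edge (S m)) :
  0 <= push_edges (circuit_mean R c) e'.
Proof.
by rewrite push_circuit_mean mulr_ge0 ?invr_ge0 // sumr_ge0.
Qed.

Lemma push_circuit_mean_le1 m k (c : {set edge (S (k + m)%N)}) (e' : edge (S m)) :
  is_circuit c -> push_edges (circuit_mean R c) e' <= 1.
Proof.
move=> cC; rewrite push_circuit_mean ler_pdivrMl ?period_gt0 // mulr1.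
apply: (@le_trans _ _ (\sum_(e in c) 1)).
  by apply: ler_sum => e _; case: (_ == _).
by rewrite sumr_const.
Qed.

Lemma edge_dist_ge (G : graph) (a b : edge_space R G) e : `|a e - b e| <= edge_dist a b.
Proof.
rewrite -sqrtr_sqr ler_wsqrtr // (bigD1 e) //= lerDl.
by apply: sumr_ge0 => *; exact: sqr_ge0.
Qed.

Lemma edge_dist_le (G : graph) (a b : edge_space R G) :
  edge_dist a b <= \sum_e `|a e - b e|.
Proof.
have sum0 : 0 <= \sum_e `|a e - b e| by apply: sumr_ge0.
rewrite -[leRHS]ger0_norm // -sqrtr_sqr ler_wsqrtr // expr2 mulr_suml.
apply: ler_sum => e _; rewrite -real_normK ?num_real // expr2.
by rewrite ler_wpM2l // (bigD1 e) //= lerDl sumr_ge0.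
Qed.

End circuit_means.

Section expressed.
Variables (R : realType) (S : cover_seq) (mu : probability (borel S) R).
Variables (N : set nat) (C : circuit_family S).
Variable s : forall n, {set edge (S n)} -> R.
Hypothesis C_circ : circuit_system N C.
Hypothesis mu_expr : expressed_by mu N C s.

Lemma system_circuit n c : N n -> c \in C n -> is_circuit c.
Proof.
by move=> Nn /(fintype.subsetP (C_circ Nn)); rewrite finset.inE => /asboolP.
Qed.

Lemma expressed_sum n (q : edge (S n) -> R) : N n ->
  \sum_e edge_weights mu n e * q e =
  \sum_(c in C n) s c * ((period c)%:R^-1 * \sum_(e in c) q e).
Proof.
move=> Nn; have [_ ->] := mu_expr Nn.
under eq_bigr do rewrite sum_ffunE mulr_suml.
rewrite exchange_big /=; apply: eq_bigr => c _.
rewrite -sum_circuit_mean mulr_sumr; apply: eq_bigr => e _.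
by rewrite ffunE mulrA.
Qed.

Lemma expressed_sum1 n : N n -> \sum_(c in C n) s c = 1.
Proof.
move=> Nn; have := expressed_sum (fun=> 1) Nn.
under eq_bigr do rewrite mulr1 edge_weightsE.
rewrite sum_edge_massT // (probability_setT mu) /= => ->.
apply: eq_bigr => c cC; rewrite sumr_const mulVf ?mulr1 //.
by rewrite gt_eqF // period_gt0 //; exact: system_circuit cC.
Qed.

Lemma expressed_push m k (e' : edge (S m)) : N (k + m)%N ->
  \sum_(c in C (k + m)%N) s c * push_edges (circuit_mean R c) e' =
  edge_weights mu m e'.
Proof.
move=> Nn; under eq_bigr do rewrite push_circuit_mean.
rewrite -expressed_sum // edge_weightsE -(@push_edge_mass R S mu setT m k) //.
rewrite [RHS]big_mkcond; apply: eq_bigr => e _; rewrite edge_weightsE.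
by case: (_ == _); rewrite ?mulr1 ?mulr0.
Qed.

Definition deviation m k (e' : edge (S m)) : R :=
  \sum_(c in C (k + m)%N)
    s c * `|push_edges (circuit_mean R c) e' - edge_weights mu m e'|.

Lemma close_circuits_le1 m k (eps : R) : N (k + m)%N ->
  \sum_(c in close_circuits mu C m k eps) s c <= 1.
Proof.
move=> Nn; have [s0 _] := mu_expr Nn; rewrite -(expressed_sum1 Nn).
rewrite [leRHS](bigID (mem (close_circuits mu C m k eps))) /=.
rewrite [X in _ <= X + _](_ : _ = \sum_(c in close_circuits mu C m k eps) s c).
  by rewrite lerDl sumr_ge0 // => c /andP[cC _]; exact: s0.
by apply: eq_bigl => c; rewrite finset.inE andbA andbb.
Qed.

(** Markov's inequality for the weights s: the absolute differences that a
    circuit contributes, summed over the edges of level m, are at least its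
    Euclidean distance to mu_m, which exceeds eps if it is not close. *)
Lemma far_circuits_le m k (eps : R) : 0 < eps -> N (k + m)%N ->
  eps * (1 - \sum_(c in close_circuits mu C m k eps) s c) <=
  \sum_(e' : edge (S m)) deviation k e'.
Proof.
move=> eps0 Nn; have [s0 _] := mu_expr Nn.
rewrite -(expressed_sum1 Nn) [X in X - _](bigID (mem (close_circuits mu C m k eps))) /=.
rewrite [X in X + _ - _](_ : _ = \sum_(c in close_circuits mu C m k eps) s c); last first.
  by apply: eq_bigl => c; rewrite finset.inE andbA andbb.
rewrite addrAC subrr add0r mulr_sumr /deviation exchange_big /=.
rewrite [leRHS](bigID (mem (close_circuits mu C m k eps))) /= ler_wpDl //.
  by apply: sumr_ge0 => c /andP[cC _]; apply: sumr_ge0 => e _; rewrite mulr_ge0 ?s0.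
apply: ler_sum => c /andP[cC]; rewrite finset.inE cC /= -ltNge => /ltW eps_le.
rewrite -mulr_sumr mulrC ler_wpM2l ?s0 // (le_trans eps_le) //.
apply: (le_trans (edge_dist_le _ _)).
by apply: ler_sum => e _; rewrite distrC.
Qed.

(** A close circuit contributes at most eps times its weight, any other one at
    most its weight, since both proportions lie in the unit interval. *)
Lemma deviation_le m k (e' : edge (S m)) (eps : R) : 0 <= eps -> N (k + m)%N ->
  deviation k e' <= eps + (1 - \sum_(c in close_circuits mu C m k eps) s c).
Proof.
move=> eps0 Nn; have [s0 _] := mu_expr Nn.
have S1 := expressed_sum1 Nn; rewrite -[X in X - _]S1.
have := S1; rewrite /deviation.
rewrite (bigID (mem (close_circuits mu C m k eps))) /=.
rewrite [leLHS](bigID (mem (close_circuits mu C m k eps))) /=.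
have closeE (F : {set edge (S (k + m)%N)} -> R) :
    \sum_(c in C (k + m)%N | c \in close_circuits mu C m k eps) F c =
    \sum_(c in close_circuits mu C m k eps) F c.
  by apply: eq_bigl => c; rewrite finset.inE andbA andbb.
rewrite !closeE => sum1.
have close_le : \sum_(c in close_circuits mu C m k eps)
    s c * `|push_edges (circuit_mean R c) e' - edge_weights mu m e'| <=
    \sum_(c in close_circuits mu C m k eps) s c * eps.
  apply: ler_sum => c; rewrite finset.inE => /andP[cC c_close].
  rewrite ler_wpM2l ?s0 // distrC.
  exact: le_trans (edge_dist_ge _ _ _) c_close.
have close1 : \sum_(c in close_circuits mu C m k eps) s c * eps <= eps.
  rewrite -mulr_suml ler_piMl // -sum1 lerDl sumr_ge0 // => c /andP[cC _].
  exact: s0.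
have far_le : \sum_(c in C (k + m)%N | c \notin close_circuits mu C m k eps)
    s c * `|push_edges (circuit_mean R c) e' - edge_weights mu m e'| <=
    \sum_(c in C (k + m)%N | c \notin close_circuits mu C m k eps) s c.
  apply: ler_sum => c /andP[cC _]; rewrite ler_piMr ?s0 //.
  have := push_circuit_mean_ge0 R c e'.
  have := push_circuit_mean_le1 R e' (system_circuit Nn cC).
  have := edge_mass_ge0 mu setT e'.
  have : edge_mass mu setT e' <= 1.
    rewrite -[leRHS]/(fine 1%E) -(probability_setT mu) -(sum_edge_massT mu m) //.
    by rewrite (bigD1 e') //= lerDl sumr_ge0 // => *; exact: edge_mass_ge0.
  by rewrite -edge_weightsE ler_norml => ? ? ? ?; lra.
lra.
Qed.

End expressed.

(** * Ergodic measures concentrate on good circuits *)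

Section visits.
Variables (R : realType) (S : cover_seq) (m : nat) (e' : edge (S m)).

Definition crossing (x : borel S) : R := (edge_at m x == e')%:R.

Lemma crossing_ge0 x : 0 <= crossing x. Proof. exact: ler0n. Qed.

Lemma crossing_indic : crossing = \1_(edge_cylinder e').
Proof.
apply/funext => x; rewrite indicE -edge_at_fibre /crossing; congr (nat_of_bool _)%:R.
by apply/eqP/idP => [xe|/set_mem //]; apply/mem_set.
Qed.

Lemma crossing_measurable : measurable_fun [set: borel S] crossing.
Proof.
rewrite crossing_indic; apply: measurable_indic; exact: edge_cylinder_measurable.
Qed.

Lemma crossingE x : crossing x =
  ((thread_coord x m, thread_coord (shift_map x) m) == sval e')%:R.
Proof. by rewrite /crossing -val_eqE. Qed.

(** Whether the orbit crosses e' at time i < r is read off coordinate m at times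
    i and i.+1, which coordinate n >= r + m of the starting point determines. *)
Lemma visits_coord (r n : nat) (x : borel S) : (r + m <= n)%N ->
  birkhoff_sum (@shift_map S) crossing r x =
  birkhoff_sum (@shift_map S) crossing r (lift_thread (thread_coord x n)).
Proof.
move=> rmn; apply: eq_bigr => i _; rewrite !crossingE -!iterS.
have ir : (i.+1 + m <= n)%N by rewrite (leq_trans _ rmn) // leq_add2r.
have xl : thread_coord x n = thread_coord (lift_thread (thread_coord x n)) n.
  by rewrite lift_threadK.
rewrite -(iter_shift_coord_le ir xl) -(iter_shift_coord_le (ltnW ir) xl) //.
Qed.

(** Started at a vertex of the circuit, the orbit follows the circuit for r
    steps as far as level m can see.  The step taken at time i, as the starting
    vertex runs over the circuit, visits every edge of the circuit once. *)
Lemma visits_circuit (r k : nat) (s : seq (S (k + m)%N)) : (r <= k)%N ->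
  ucycle (fun u v => (u, v) \in edges (S (k + m)%N)) s ->
  \sum_(e in cycle_edges s)
    birkhoff_sum (@shift_map S) crossing r (lift_thread (source e)) =
  r%:R * \sum_(e in cycle_edges s)
    ((bond_iter (source e), bond_iter (target e)) == sval e')%:R.
Proof.
move=> rk cyc_s; have us : uniq s by case/andP: cyc_s.
rewrite (sum_cycle_edges (fun v _ =>
  birkhoff_sum (@shift_map S) crossing r (lift_thread v))) //.
pose H (u v : S (k + m)%N) : R := ((bond_iter u, bond_iter v) == sval e')%:R.
rewrite [X in _ = _ * X](sum_cycle_edges H cyc_s) exchange_big /=.
transitivity (\sum_(i < r) \sum_(v in s) H v (next s v)); last first.
  by rewrite sumr_const card_ord mulr_natl.
apply: eq_bigr => i _.
rewrite -(sum_iter_next (fun v => H v (next s v)) i us); apply: eq_bigr => v sv.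
have walk j : (iter j (next s) v, iter j.+1 (next s) v) \in edges (S (k + m)%N).
  have sj : iter j (next s) v \in s by elim: j => //= j; rewrite mem_next.
  by have /andP[cyc _] := cyc_s; exact: (next_cycle cyc sj).
have ik : (i.+1 + m <= k + m)%N by rewrite leq_add2r (leq_trans _ rk).
rewrite crossingE -iterS (iter_shift_walk ik walk).
rewrite (iter_shift_walk (ltnW ik) walk).
by rewrite -!(@thread_bond_iter _ _ m k) !lift_threadK.
Qed.

End visits.

Section ergodic_to_concentration.
Variables (R : realType) (S : cover_seq) (mu : probability (borel S) R).
Variables (N : set nat) (C : circuit_family S).
Variable s : forall n, {set edge (S n)} -> R.
Hypothesis mu_inv : shift_invariant mu.
Hypothesis C_circ : circuit_system N C.
Hypothesis mu_expr : expressed_by mu N C s.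
Hypothesis mu_erg : ergodic mu.

(** The proportion of the circuit over e' is the mean along it of the visit
    averages over r steps, which are at most p + delta, or at most 1 at the
    vertices counted on the right. *)
Lemma circuit_excess m k r (e' : edge (S m)) (delta : R) (c : {set edge (S (k + m)%N)}) :
  (0 < r <= k)%N -> 0 <= delta -> is_circuit c ->
  Num.max 0 (push_edges (circuit_mean R c) e' - edge_weights mu m e') <=
  delta + (period c)%:R^-1 * \sum_(e in c)
    (r%:R * (edge_weights mu m e' + delta) <
     birkhoff_sum (@shift_map S) (crossing R e') r (lift_thread (source e)))%R%:R.
Proof.
set p := edge_weights mu m e'.
pose q (e : edge (S (k + m)%N)) := (r%:R * (p + delta) <
  birkhoff_sum (@shift_map S) (crossing R e') r (lift_thread (source e)))%R.
rewrite -[X in _ <= _ + _ * X]/(\sum_(e in c) (q e)%:R).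
move=> /andP[r0 rk] delta0 cC; have c0 := period_gt0 R cC.
have p0 : 0 <= p by rewrite /p edge_weightsE edge_mass_ge0.
rewrite ge_max addr_ge0 //=; last by rewrite mulr_ge0 ?invr_ge0 ?(ltW c0) ?sumr_ge0.
rewrite push_circuit_mean lerBlDl addrA mulrC ler_pdivrMr // mulrDl.
rewrite mulrAC mulVf ?gt_eqF // mul1r.
have r0' : 0 < r%:R :> R by rewrite ltr0n.
rewrite -(ler_pM2l r0').
have [t [_ cyc_t cE]] := cC.
rewrite {1}cE -(visits_circuit R e' rk cyc_t) -cE.
rewrite [X in _ * (X + _)](_ : _ = \sum_(e in c) (p + delta)); last first.
  by rewrite sumr_const mulr_natr.
rewrite -big_split mulr_sumr /=; apply: ler_sum => e _.
case: (boolP (q e)) => [_|]; last by rewrite /q -leNgt addr0.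
apply: (@le_trans _ _ r%:R).
  rewrite /birkhoff_sum -[leRHS]mulr1n -[X in _ <= X](_ : \sum_(i < r) 1 = _).
    by apply: ler_sum => i _; rewrite /crossing; case: (_ == _).
  by rewrite sumr_const card_ord.
rewrite ler_peMr ?(ltW r0') // -[true%:R]/(1 : R); lra.
Qed.

(** The length r is fixed first, by the ergodic theorem; the estimate then holds
    at all levels above m + r.  An absolute value is twice the positive part
    minus the value, and the values q(c) - p have mean 0. *)
Lemma ergodic_deviation m (e' : edge (S m)) (eps : R) : 0 < eps ->
  exists K, forall k, (K <= k)%N -> N (k + m)%N -> deviation mu C s k e' <= eps.
Proof.
move=> eps0; pose delta := eps / 4; have delta0 : 0 < delta by rewrite divr_gt0.
set p := edge_weights mu m e'.
have hE : (\int[mu]_x (crossing R e' x)%:E = p%:E)%E.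
  rewrite crossing_indic integral_indic //; last exact: edge_cylinder_measurable.
  rewrite setIT /p ffunE fineK //; apply: fin_num_measure.
  exact: edge_cylinder_measurable.
have pd : (\int[mu]_x (crossing R e' x)%:E < (p + delta)%:E)%E.
  by rewrite hE lte_fin ltrDl.
have [K0 _ /(_ K0.+1 (leqnSn _)) /= tail] := ergodic_average_upper
  (@shift_measurable S) mu_inv mu_erg (@crossing_measurable R S m e')
  (@crossing_ge0 R S m e') delta0 pd.
set r := K0.+1 in tail.
exists r => k rk Nn; have [s0 _] := mu_expr Nn.
pose q (e : edge (S (k + m)%N)) := (r%:R * (p + delta) <
    birkhoff_sum (@shift_map S) (crossing R e') r (lift_thread (source e)))%R.
have q_le : \sum_e edge_weights mu (k + m)%N e * (q e)%:R <= delta.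
  rewrite (_ : \sum_e _ = \sum_(e | q e) edge_mass mu setT e); last first.
    rewrite [RHS]big_mkcond; apply: eq_bigr => e _; rewrite edge_weightsE.
    by case: (q e); rewrite ?mulr1 ?mulr0.
  rewrite sum_edge_mass // setTI -lee_fin fineK; last first.
    apply: fin_num_measure.
    exact: (fibres_measurable (@edge_at_measurable S (k + m)%N)).
  apply: le_trans tail; rewrite le_eqVlt; apply/orP; left; apply/eqP.
  congr (mu _); apply/seteqP; split => x; rewrite /q /=.
    by rewrite -visits_coord // leq_add2r.
  by rewrite [X in _ < X](@visits_coord _ _ _ _ r (k + m)%N) // leq_add2r.
have excess : \sum_(c in C (k + m)%N)
    s c * Num.max 0 (push_edges (circuit_mean R c) e' - p) <= 2 * delta.
  apply: (@le_trans _ _ (\sum_(c in C (k + m)%N)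
      s c * (delta + (period c)%:R^-1 * \sum_(e in c) (q e)%:R))).
    apply: ler_sum => c cC; rewrite ler_wpM2l ?s0 //.
    apply: circuit_excess; rewrite ?(ltW delta0) //.
    exact: system_circuit C_circ _ _ Nn cC.
  under eq_bigr do rewrite mulrDr.
  rewrite big_split /= -mulr_suml (expressed_sum1 C_circ mu_expr Nn) mul1r.
  rewrite -(expressed_sum mu_expr (fun e => (q e)%:R) Nn).
  by rewrite mulr_natl mulr2n lerD2l.
have centered : \sum_(c in C (k + m)%N)
    s c * (push_edges (circuit_mean R c) e' - p) = 0.
  under eq_bigr do rewrite mulrBr.
  rewrite sumrB (expressed_push mu_expr) // -mulr_suml.
  by rewrite (expressed_sum1 C_circ mu_expr Nn) mul1r subrr.
rewrite /deviation -/p (_ : \sum_(c in _) _ =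
    2 * (\sum_(c in C (k + m)%N)
      s c * Num.max 0 (push_edges (circuit_mean R c) e' - p)) -
    \sum_(c in C (k + m)%N) s c * (push_edges (circuit_mean R c) e' - p)).
  by rewrite centered subr0; move: excess; rewrite /delta; lra.
rewrite mulr_sumr -sumrB; apply: eq_bigr => c _.
rewrite mulrCA -mulrBr; congr (_ * _).
by case: (leP 0 (push_edges (circuit_mean R c) e' - p)) => h;
  [rewrite ger0_norm // | rewrite ltr0_norm //]; lra.
Qed.

Lemma ergodic_concentrate : circuits_concentrate mu N C s.
Proof.
move=> m Nm eps eps0; apply/cvgrPdist_le => eta eta0.
pose E := #|edge (S m)|.
have E0 : 0 < E.+1%:R :> R by rewrite ltr0n.
have d0 : 0 < eps * eta / E.+1%:R by rewrite divr_gt0 // mulr_gt0.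
have [K KP] := choice (fun e' : edge (S m) => ergodic_deviation e' d0).
rewrite near_withinE; exists (\max_e K e)%N => // k /= Kk Nn.
have far_ge0 : 0 <= 1 - \sum_(c in close_circuits mu C m k eps) s c.
  by rewrite subr_ge0; exact: (close_circuits_le1 C_circ mu_expr).
rewrite ger0_norm // -(ler_pM2l eps0).
apply: (le_trans (far_circuits_le C_circ mu_expr eps0 Nn)).
apply: (@le_trans _ _ (\sum_(e' : edge (S m)) eps * eta / E.+1%:R)).
  apply: ler_sum => e' _; apply: KP => //.
  by apply: leq_trans Kk; exact: leq_bigmax.
rewrite sumr_const -[leLHS]mulr_natl -/E mulrCA.
rewrite ler_piMr ?mulr_ge0 ?(ltW eps0) ?(ltW eta0) //.
by rewrite ler_pdivrMr // mul1r ler_nat leqnSn.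
Qed.

End ergodic_to_concentration.

(** * Concentration forces ergodicity *)

Section concentration_to_ergodic.
Variables (R : realType) (S : cover_seq) (mu : probability (borel S) R).
Variables (N : set nat) (C : circuit_family S).
Variable s : forall n, {set edge (S n)} -> R.
Hypothesis mu_inv : shift_invariant mu.
Hypothesis N_inf : infinite_set N.
Hypothesis C_circ : circuit_system N C.
Hypothesis mu_expr : expressed_by mu N C s.
Hypothesis indep : forall n, N n -> circuits_independent R (S n).

Variable A : set (borel S).
Hypothesis mA : measurable A.
Hypothesis A_inv : @shift_map S @^-1` A = A.

(** The circuit weights of the restrictions of mu to A and to its complement add
    up to those of mu, which independence makes unique; both being nonnegative,
    those of A are bounded by those of mu, and vanish outside C n. *)
Lemma invariant_circuit_weights n : N n ->
  exists t : {set edge (S n)} -> R,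
    [/\ forall c, 0 <= t c,
        forall e, edge_mass mu A e = \sum_(c in Circ (S n)) t c * (e \in c)%:R
      & forall c, c \in Circ (S n) ->
          t c * (period c)%:R <= (if c \in C n then s c else 0)].
Proof.
move=> Nn; have mAC := measurableC mA.
have AC_inv : @shift_map S @^-1` (~` A) = ~` A by rewrite -[in RHS]A_inv.
have [t t_ge0 tE] := circulation_decomposition (@edge_mass_ge0 R S mu A n)
  (edge_mass_circulation mu_inv mA A_inv).
have [t' t'_ge0 t'E] := circulation_decomposition (@edge_mass_ge0 R S mu (~` A) n)
  (edge_mass_circulation mu_inv mAC AC_inv).
exists t; split=> // c cC.
have c0 : 0 < (period c)%:R :> R.
  by move: cC; rewrite finset.inE => /asboolP; exact: period_gt0.
pose w (d : {set edge (S n)}) : R := if d \in C n then s d / (period d)%:R else 0.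
have /(_ _ cC) : forall d, d \in Circ (S n) -> t d + t' d - w d = 0.
  apply: circuits_independent_eq0; first exact: indep.
  move=> e; under eq_bigr do rewrite mulrBl mulrDl.
  rewrite sumrB big_split /= -tE -t'E.
  have -> : edge_mass mu A e + edge_mass mu (~` A) e = edge_weights mu n e.
    have mAe : measurable (A `&` edge_cylinder e).
      by apply: measurableI => //; exact: edge_cylinder_measurable.
    have mACe : measurable (~` A `&` edge_cylinder e).
      by apply: measurableI => //; exact: edge_cylinder_measurable.
    rewrite edge_weightsE /edge_mass -fineD; last 2 first.
    - by apply: fin_num_measure; exact: mAe.
    - by apply: fin_num_measure; exact: mACe.
    rewrite -measureU; last 3 first.
    - exact: mAe.
    - exact: mACe.
    - by rewrite setIACA setICr set0I.
    by rewrite -setIUl setUCr.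
  have [_ ->] := mu_expr Nn; rewrite sum_ffunE; apply/eqP; rewrite subr_eq0.
  apply/eqP; rewrite [LHS]big_mkcond [RHS]big_mkcond; apply: eq_bigr => d _.
  rewrite /w; case: (boolP (d \in C n)) => [dC|_]; last by rewrite mul0r if_same.
  by rewrite (fintype.subsetP (C_circ Nn)) // !ffunE -mulrA.
move=> /eqP; rewrite subr_eq0 => /eqP tw; rewrite -ler_pdivlMr //.
apply: (@le_trans _ _ (w c)); first by rewrite -tw lerDl.
by rewrite /w; case: ifP => // _; rewrite mul0r.
Qed.

(** With weights t for the restriction to A, the left-hand side is the absolute
    value of the sum of t(c) per(c) (q(c) - p), where t(c) per(c) <= s(c). *)
Lemma invariant_edge_deviation m k (e' : edge (S m)) : N (k + m)%N ->
  `|edge_mass mu A e' - fine (mu A) * edge_weights mu m e'| <=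
  deviation mu C s k e'.
Proof.
move=> Nn; have [t [t_ge0 tE ts]] := invariant_circuit_weights Nn.
set p := edge_weights mu m e'.
have -> : edge_mass mu A e' = \sum_(c in Circ (S (k + m)%N))
    t c * (period c)%:R * push_edges (circuit_mean R c) e'.
  rewrite -(@push_edge_mass R S mu A m k) //.
  under eq_bigr do rewrite tE.
  rewrite exchange_big /=; apply: eq_bigr => c; rewrite finset.inE => /asboolP cC.
  rewrite push_circuit_mean -mulrA mulVKf ?gt_eqF ?period_gt0 // -mulr_sumr.
  congr (_ * _); rewrite big_mkcond [RHS]big_mkcond; apply: eq_bigr => e _.
  by case: (_ == _); case: (_ \in _).
have -> : fine (mu A) = \sum_(c in Circ (S (k + m)%N)) t c * (period c)%:R.
  rewrite -(sum_edge_massT mu (k + m)%N mA).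
  under eq_bigr do rewrite tE.
  rewrite exchange_big /=; apply: eq_bigr => c _.
  rewrite -mulr_sumr; congr (_ * _).
  rewrite -[RHS](sumr_const (mem c) 1) [RHS]big_mkcond; apply: eq_bigr => e _.
  by case: (_ \in _).
rewrite mulr_suml -sumrB.
apply: (@le_trans _ _ (\sum_(c in Circ (S (k + m)%N)) (if c \in C (k + m)%N then
    s c * `|push_edges (circuit_mean R c) e' - p| else 0))).
  apply: (le_trans (ler_norm_sum _ _ _)); apply: ler_sum => c cC.
  rewrite -mulrBr normrM ger0_norm ?mulr_ge0 //.
  apply: (le_trans (ler_wpM2r (normr_ge0 _) (ts _ cC))).
  by case: ifP => // _; rewrite mul0r.
rewrite /deviation -/p [leLHS]big_mkcond [leRHS]big_mkcond /=.
apply: ler_sum => c _; case: (boolP (c \in C _)) => [cC|_]; last by rewrite if_same.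
by rewrite (fintype.subsetP (C_circ Nn)).
Qed.

Hypothesis conc : circuits_concentrate mu N C s.

(** At levels of N the deviation tends to 0 along N; other levels are reached by
    pushing masses down from a higher level of N. *)
Lemma invariant_edge_mass n (e : edge (S n)) :
  edge_mass mu A e = fine (mu A) * edge_mass mu setT e.
Proof.
have N_large j : exists2 i, N i & (j <= i)%N.
  apply: contrapT => noN; apply: N_inf; apply: (sub_finite_set _ (finite_II j)).
  by move=> i Ni /=; rewrite ltnNge; apply/negP => ji; apply: noN; exists i.
have massN m (e' : edge (S m)) : N m ->
    edge_mass mu A e' = fine (mu A) * edge_mass mu setT e'.
  move=> Nm; apply/eqP; rewrite -subr_eq0 -normr_le0 -edge_weightsE.
  apply/ler_addgt0Pr => eps eps0; rewrite add0r.
  have e2 : 0 < eps / 2 by rewrite divr_gt0.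
  have /cvgrPdist_le /(_ _ e2) := conc Nm e2.
  rewrite near_withinE => -[K _ KP].
  have [i Ni] := N_large (K + m)%N.
  move=> Ki; have mi : (m <= i)%N by rewrite (leq_trans _ Ki) // leq_addl.
  rewrite -(subnK mi) in Ni Ki; rewrite leq_add2r in Ki.
  have /= far := KP _ Ki Ni.
  apply: (le_trans (invariant_edge_deviation _ Ni)).
  apply: (le_trans (deviation_le C_circ mu_expr e' (ltW e2) Ni)).
  by have := le_trans (ler_norm _) far; lra.
have [i Ni ni] := N_large n; move: Ni; rewrite -(subnK ni) => Ni.
rewrite -!(@push_edge_mass R S mu _ n (i - n)) // mulr_sumr.
by apply: eq_bigr => e' _; exact: massN.
Qed.

(** Both sides are finite measures in B which agree on cylinders, a pi-system
    that generates the Borel sets. *)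
Lemma invariant_independent (B : set (borel S)) : measurable B ->
  mu (A `&` B) = (fine (mu A) * fine (mu B))%:E.
Proof.
move=> mB.
pose m1 : {measure set (borel S) -> \bar R} := mrestr mu mA.
have fA0 : 0 <= fine (mu A) by exact/fine_ge0/measure_ge0.
pose m2 : {measure set (borel S) -> \bar R} := mscale (NngNum fA0) mu.
have m2E D : measurable D -> m2 D = (fine (mu A) * fine (mu D))%:E.
  move=> mD; have /fineK muD : mu D \is a fin_num by apply: fin_num_measure.
  by rewrite EFinM muD.
rewrite -(m2E _ mB) setIC -[LHS]/(m1 B).
have cylT : exists n (v : S n), setT = vertex_cylinder v.
  have [x _] := inverse_limit_inhabited S.
  exists 0, (thread_coord x 0); apply/seteqP; split=> // y _.
  by apply: fintype_le1P; rewrite level0.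
apply: (measure_unique _ (fun=> setT) (@measurable_cylinders S)
  (@cylinders_setI S)) => //.
- by move=> _; right.
- by rewrite bigcup_const.
- move=> D [->|[n [v ->]]]; first by rewrite !measure0.
  rewrite m2E ?/m1 /= /mrestr; last exact: vertex_cylinder_measurable.
  rewrite setIC -[LHS]fineK; last first.
    apply: fin_num_measure; apply: measurableI => //.
    exact: vertex_cylinder_measurable.
  congr _%:E; rewrite -sum_edge_mass_source //.
  rewrite -[vertex_cylinder v in RHS]setTI -sum_edge_mass_source // mulr_sumr.
  by apply: eq_bigr => e _; exact: invariant_edge_mass.
- move=> _; rewrite /m1 /= /mrestr setTI.
  by rewrite (le_lt_trans (probability_le1 _ _)) // ltry.
Qed.

Lemma invariant_trivial : mu A = 0%E \/ mu A = 1%E.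
Proof.
have := invariant_independent mA; rewrite setIid.
have /fineK <- : mu A \is a fin_num by apply: fin_num_measure.
move=> /= -[]; set x := fine _ => xx.
have /eqP : x * (1 - x) = 0 by rewrite mulrBr mulr1 -xx subrr.
rewrite mulf_eq0 subr_eq0 => /orP[/eqP ->|/eqP <-]; by [left|right].
Qed.

End concentration_to_ergodic.

Theorem theorem4p20 (R : realType) (S : cover_seq)
    (mu : probability (borel S) R) (mu_inv : shift_invariant mu)
    (N : set nat) (N_inf : infinite_set N)
    (C : circuit_family S) (C_circ : circuit_system N C)
    (s : forall n, {set edge (S n)} -> R) (mu_expr : expressed_by mu N C s) :
  (ergodic mu -> circuits_concentrate mu N C s) /\
  ((forall n, N n -> circuits_independent R (S n)) ->
   (ergodic mu <-> circuits_concentrate mu N C s)).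
Proof.
have ergC : ergodic mu -> circuits_concentrate mu N C s.
  exact: ergodic_concentrate mu_inv C_circ mu_expr.
split=> // indep; split=> // conc A mA A_inv.
exact: (invariant_trivial mu_inv N_inf C_circ mu_expr indep mA A_inv conc).
Qed.
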